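(* Let $\mathrm{SAT}(n,m)$ be a SAT instance in conjunctive normal form. If there exists a subset $L$ of its rows that is isomorphic to an unsatisfactory board, then $\mathrm{SAT}(n,m)$ has no solution, i.e. no assignment in $\{0,1\}^n$ satisfies all its rows.
   Context: $\mathrm{SAT}(n,m)$ denotes a conjunction of $m$ row formulas over Boolean variables $x_{n-1},\dots,x_0$, each row being a disjunction of literals containing at least one variable, each variable occurring at most once in a row (as $x_i$ or as $\overline{x}_i$). A subset $L$ of the rows is isomorphic to an unsatisfactory board if there are an integer $k\ge 1$ and a set $V$ of $k$ of the variables such that every row in $L$ contains exactly the variables of $V$, and the rows in $L$ realize all $2^k$ possible choices of signs: for each function $\sigma:V\to\{0,1\}$ there is a row in $L$ in which each $v\in V$ occurs positively if $\sigma(v)=1$ and negated if $\sigma(v)=0$. *)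

(* Defs.v *)
From mathcomp Require Import all_boot.

Set Implicit Arguments.
Unset Strict Implicit.
Unset Printing Implicit Defensive.

(* (i, true) is the literal x_i, (i, false) is its negation. *)
Definition literal (n : nat) : Type := ('I_n * bool)%type.

Record row (n : nat) : Type := Row {
  row_lits :> seq (literal n);
  row_nonempty : row_lits != [::];
  row_uniq : uniq [seq l.1 | l <- row_lits]
}.

Definition SAT (n m : nat) : Type := m.-tuple (row n).

Definition assignment (n : nat) : Type := {ffun 'I_n -> bool}.

Definition lit_value n (a : assignment n) (l : literal n) : bool :=
  if l.2 then a l.1 else ~~ a l.1.

Definition row_value n (a : assignment n) (r : row n) : bool :=
  has (lit_value a) (row_lits r).

Definition satisfies n m (a : assignment n) (phi : SAT n m) : bool :=
  [forall j : 'I_m, row_value a (tnth phi j)].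

Definition row_vars n (r : row n) : {set 'I_n} :=
  [set i in [seq l.1 | l <- row_lits r]].

(* L is a set of row indices, since distinct rows may be syntactically equal. *)
Definition iso_unsatisfactory_board n m (phi : SAT n m) (L : {set 'I_m}) : Prop :=
  exists (k : nat) (V : {set 'I_n}),
    [/\ 1 <= k,
        #|V| = k,
        forall j : 'I_m, j \in L -> row_vars (tnth phi j) = V
      & forall sigma : {v : 'I_n | v \in V} -> bool,
          exists2 j : 'I_m, j \in L &
            forall v : {v : 'I_n | v \in V},
              (val v, sigma v) \in row_lits (tnth phi j)].

(* Main.v *)
Require Import Defs.
From mathcomp Require Import all_boot.

(** Every assignment fails on one row of the board: the one that contradicts it at each variable of
    [V]. A row mentions a variable only once, which [uniq_map_inj_in] turns into uniqueness of its
    literal, so no other literal can rescue that row. *)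

Lemma uniq_map_inj_in (T1 T2 : eqType) (f : T1 -> T2) (s : seq T1) :
  uniq [seq f x | x <- s] -> {in s &, injective f}.
Proof.
elim: s => [//|z s IHs] /= /andP[fz_notin uniq_fs] x y.
rewrite !inE => /predU1P[->|xs] /predU1P[->|ys] //; last exact: IHs.
- by move=> fE; rewrite fE map_f in fz_notin.
- by move=> fE; rewrite -fE map_f in fz_notin.
Qed.

(* The row of the board whose signs are opposite to the values of the
   assignment is falsified. *)
Theorem proposition2 (n m : nat) (phi : SAT n m) :
  (exists L : {set 'I_m}, iso_unsatisfactory_board phi L) ->
  ~ (exists a : assignment n, satisfies a phi).
Proof.
move=> [L [k [V [_ _ varsL signsL]]]] [a /forallP sat_a].
have [j jL opp_row] := signsL (fun v => ~~ a (val v)).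
have /hasP[l l_row l_true] := sat_a j.
have lV : l.1 \in V by rewrite -(varsL j jL) inE map_f.
(* Both literals lie in row [j] and share the variable [l.1], so they coincide. *)
have l_opp : l = (l.1, ~~ a l.1).
  exact: (@uniq_map_inj_in _ _ _ _ (row_uniq (tnth phi j)) _ _
            l_row (opp_row (exist _ l.1 lV))).
by move: l_true; rewrite l_opp /lit_value /=; case: (a l.1).
Qed.
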